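(* Assume the coefficient hypotheses below. Consider any family of discrete solutions $u_j(h,\mathbf{x}^{n}_{j,i})$, $j=1,\dots,J$, of the scheme $G_j=0$ (defined below) on grids $\Omega_{j,h}$ with $\Delta\tau\to0$ as $h\to0$, which satisfies Conditions (C1)–(C4) below. Then, as $h\to0$, for each $j$ the discrete solution $u_j(h,\cdot)$ converges, uniformly on bounded domains, to $U_j$, where $U=(U_1,\dots,U_J)$ is the unique continuous viscosity solution of the localized switching system (S) below.
   Context: Setting: controls $Q=\{q_1,\dots,q_J\}$; for each $j$, $L_{q_j}V=\mathrm{tr}(\sigma_{q_j}\sigma_{q_j}^TD^2V)+\mu_{q_j}^TDV-r_{q_j}V+f_{q_j}$ with coefficients bounded and Lipschitz in $\mathbf{x}=(S,\tau)$ (uniformly in $j$). Fix a switching cost $c>0$, a bounded computational domain $\Omega\subset\mathbb{R}^d$, a portion $\partial\hat\Omega\subset\partial\Omega$ with Dirichlet data $\mathcal{B}_j$, initial datum $\mathcal{G}$, horizon $T$. The localized switching system (S) is: for $j=1,\dots,J$, $F_j(\mathbf{x},U_j,DU_j,D^2U_j,\{U_k\}_{k\ne j})=0$, where $F_j=\min\big[U_{j,\tau}-L_{q_j}U_j,\;U_j-\max_{k\ne j}(U_k-c)\big]$ on $(\Omega\setminus\partial\hat\Omega)\times(0,T]$, $F_j=U_j-\mathcal{G}$ on $\Omega\times\{0\}$, $F_j=U_j-\mathcal{B}_j$ on $\partial\hat\Omega\times(0,T]$. Viscosity (sub/super)solutions of (S): $U:\Omega\to\mathbb{R}^J$ locally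 bounded is a subsolution (supersolution) if for each $j$, every $C^\infty$ $\phi_j$ and every maximum (minimum) point $\mathbf{x}$ of $U_j^*-\phi_j$ ($U_{j*}-\phi_j$), $F_{j*}(\mathbf{x},U_j^*(\mathbf{x}),D\phi_j(\mathbf{x}),D^2\phi_j(\mathbf{x}),\{U_k^*(\mathbf{x})\}_{k\ne j})\le0$ (resp. $F_j^*(\mathbf{x},U_{j*},D\phi_j,D^2\phi_j,\{U_{k*}(\mathbf{x})\}_{k\ne j})\ge0$); the test function replaces only derivatives of $U_j$. It is assumed (as holds under these coefficient assumptions) that a strong comparison principle holds for (S). Discretization: for each $j$ a spatial grid with nodes $S_{j,i}$ and times $\tau^n$ with constant step $\Delta\tau$, $\max_{j}\sup_{S\in\Omega}\min_i|S-S_{j,i}|=h$; $\mathbf{x}^n_{j,i}=(S_{j,i},\tau^n)\in\Omega_{j,h}$; $u^n_{j,i}=u_j(h,\mathbf{x}^n_{j,i})$; $L^h_{q_j}$ is a discrete version of $L_{q_j}$ on grid $j$; $\tilde u^n_{k,i(j)}$ denotes the value at $\mathbf{x}^n_{j,i}$ of an interpolant of the grid values $u^n_{k,\cdot}$ on grid $k$. The scheme (piecewise constant policy timestepping) is $u^{n+1/2}_{j,i}=\max[u^n_{j,i},\max_{k\ne j}(\tilde u^n_{k,i(j)}-c)]$, $u^{n+1}_{j,i}-\Delta\tau L^h_{q_j}u^{n+1}_{j,i}=u^{n+1/2}_{j,i}$, equivalently $G_j=0$ with $$G_j\Big(\mathbf{x}^{n+1}_{j,i},h,u^{n+1}_{j,i},\{u^{b+1}_{j,a}\}_{a\ne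 i\text{ or }b\ne n},\{\tilde u^n_{k,i(j)}\}_{k\ne j}\Big)=\min\Big[\tfrac{u^{n+1}_{j,i}-u^n_{j,i}}{\Delta\tau}-L^h_{q_j}u^{n+1}_{j,i},\;u^{n+1}_{j,i}-\max_{k\ne j}(\tilde u^n_{k,i(j)}-c)-\Delta\tau L^h_{q_j}u^{n+1}_{j,i}\Big]$$ at interior nodes, with the trivial discretizations of the initial and Dirichlet conditions elsewhere; $\{u^{b+1}_{j,a}\}_{a\ne i\text{ or }b\ne n}$ denotes the neighbouring (in space and time) nodal values on grid $j$. (C1) Positive interpolation: $\tilde u^n_{k,i(j)}=\sum_{\alpha\in N^k(j,i,n)}\omega^n_{k,i(j),\alpha}u^n_{k,\alpha}$ with $\omega^n_{k,i(j),\alpha}\ge0$, $\sum_\alpha\omega^n_{k,i(j),\alpha}=1$, where $N^k(j,i,n)$ are neighbours of $\mathbf{x}^n_{j,i}$ on grid $\Omega_{k,h}$ (the weights may depend nonlinearly on the data, e.g. any interpolant satisfying $\min_\alpha u^n_{k,\alpha}\le\tilde u^n_{k,i(j)}\le\max_\alpha u^n_{k,\alpha}$). (C2) Weak monotonicity: if $w^n_{j,i}\ge u^n_{j,i}$ for all $(i,j,n)$ and $\tilde w^n_{k,i(j)}\ge\tilde u^n_{k,i(j)}$ for all $(i,k,n)$, then $G_j(\mathbf{x}^{n+1}_i,h,u^{n+1}_{j,i},\{w^{b+1}_{j,a}\},\{\tilde w^n_{k,i(j)}\}_{k\ne j})\le G_j(\mathbf{x}^{n+1}_i,h,u^{n+1}_{j,i},\{u^{b+1}_{j,a}\},\{\tilde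 u^n_{k,i(j)}\}_{k\ne j})$. (C3) $\ell_\infty$ stability: the discrete solution exists and is bounded independently of $h$. (C4) Consistency: for every smooth $\phi_j$ and any (not necessarily smooth) functions $\rho_k$, $\big|G_j(\mathbf{x}^{n+1}_{j,i},h,\phi^{n+1}_{j,i}+\xi,\{\phi^{b+1}_{j,a}\}+\xi,\{\tilde\rho_k(\mathbf{x}^n_{j,i})\}_{k\ne j})-F_j(\mathbf{x}^{n+1}_{j,i},\phi_j(\mathbf{x}^{n+1}_{j,i}),D\phi_j(\mathbf{x}^{n+1}_{j,i}),D^2\phi_j(\mathbf{x}^{n+1}_{j,i}),\{\tilde\rho_k(\mathbf{x}^n_{j,i})\}_{k\ne j})\big|\le\omega_1(h)+\omega_2(\xi)$ with $\omega_1(h)\to0$ as $h\to0$ and $\omega_2(\xi)\to0$ as $\xi\to0$. *)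

(* Defs.v *)
From HB Require Import structures.
From mathcomp Require Import all_boot all_order all_algebra.
From mathcomp Require Import all_classical all_reals all_analysis.
Set Implicit Arguments. Unset Strict Implicit. Unset Printing Implicit Defensive.
Import Order.TTheory GRing.Theory Num.Theory.
Import numFieldNormedType.Exports.
Local Open Scope classical_set_scope.
Local Open Scope ring_scope.

Section SwitchingScheme.
Context {R : realType} {d J : nat}.

(* a point x = (S, tau) *)
Definition pt := ('rV[R]_d * R)%type.

Record pde_data := PDE {
  sigma : 'I_J -> pt -> 'M[R]_d;
  mu    : 'I_J -> pt -> 'rV[R]_d;
  rcoef : 'I_J -> pt -> R;
  fcoef : 'I_J -> pt -> R;
  cost  : R;
  Om    : set 'rV[R]_d;
  bdh   : set 'rV[R]_d;
  Gini  : 'rV[R]_d -> R;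
  Bdir  : 'I_J -> pt -> R;
  Thor  : R }.

Variable P : pde_data.

Definition Dom : set pt := [set x | Om P x.1 /\ 0 <= x.2 <= Thor P].

Definition Lop (j : 'I_J) (x : pt) (r : R) (p : 'rV[R]_d) (M : 'M[R]_d) : R :=
  \tr (sigma P j x *m (sigma P j x)^T *m M)
  + \sum_(k < d) mu P j x ord0 k * p ord0 k - rcoef P j x * r + fcoef P j x.

Definition maxoth (j : 'I_J) (w : 'rV[R]_J) : R :=
  match [pick k | k != j] with
  | Some k0 => \big[Num.max/(w ord0 k0 - cost P)]_(k | k != j) (w ord0 k - cost P)
  | None => 0
  end.

(* F_j(x, r, (u_tau, DU), D^2U, {U_k}) ; pt_ = time derivative, p = spatial gradient *)
Definition Fop (j : 'I_J) (x : pt) (r pt_ : R) (p : 'rV[R]_d) (M : 'M[R]_d)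
  (w : 'rV[R]_J) : R :=
  if x.2 == 0 then r - Gini P x.1
  else if `[< bdh P x.1 >] then r - Bdir P j x
  else Num.min (pt_ - Lop j x r p M) (r - maxoth j w).

Definition nearF (e : R) (x : pt) (r pt_ : R) (p : 'rV[R]_d) (M : 'M[R]_d) (w : 'rV[R]_J)
  (y : pt) (r' pt' : R) (p' : 'rV[R]_d) (M' : 'M[R]_d) (w' : 'rV[R]_J) : Prop :=
  [/\ Dom y, `|y - x| < e, `|r' - r| < e & `|pt' - pt_| < e] /\
  [/\ `|p' - p| < e, `|M' - M| < e & `|w' - w| < e].

Definition Flo (j : 'I_J) (x : pt) (r pt_ : R) (p : 'rV[R]_d) (M : 'M[R]_d) (w : 'rV[R]_J) : R :=
  fine (ereal_sup [set ereal_inf [set z | exists y r' pt' p' M' w',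
          nearF e x r pt_ p M w y r' pt' p' M' w' /\ z = (Fop j y r' pt' p' M' w')%:E]
        | e in [set e : R | 0 < e]]).
Definition Fup (j : 'I_J) (x : pt) (r pt_ : R) (p : 'rV[R]_d) (M : 'M[R]_d) (w : 'rV[R]_J) : R :=
  fine (ereal_inf [set ereal_sup [set z | exists y r' pt' p' M' w',
          nearF e x r pt_ p M w y r' pt' p' M' w' /\ z = (Fop j y r' pt' p' M' w')%:E]
        | e in [set e : R | 0 < e]]).

Definition usc_env (D : set pt) (f : pt -> R) (x : pt) : R :=
  fine (ereal_inf [set ereal_sup [set (f y)%:E | y in D `&` [set y | `|y - x| < e]]
        | e in [set e : R | 0 < e]]).
Definition lsc_env (D : set pt) (f : pt -> R) (x : pt) : R :=
  fine (ereal_sup [set ereal_inf [set (f y)%:E | y in D `&` [set y | `|y - x| < e]]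
        | e in [set e : R | 0 < e]]).

Definition loc_bounded (D : set pt) (f : pt -> R) : Prop :=
  forall x, D x -> exists e M : R, 0 < e /\
    forall y, D y -> `|y - x| < e -> `|f y| <= M.

Fixpoint smooth_n (n : nat) (f : pt -> R) : Prop :=
  match n with
  | 0 => True
  | n'.+1 => (forall x, differentiable f x) /\
             forall v : pt, smooth_n n' (fun y => derive f y v)
  end.
Definition smooth (f : pt -> R) : Prop := forall n, smooth_n n f.

Definition eS (k : 'I_d) : pt := (delta_mx ord0 k, 0).
Definition dtau (phi : pt -> R) (x : pt) : R := derive phi x (0 : 'rV[R]_d, 1).
Definition gradS (phi : pt -> R) (x : pt) : 'rV[R]_d := \row_k derive phi x (eS k).
Definition hessS (phi : pt -> R) (x : pt) : 'M[R]_d :=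
  \matrix_(k, l) derive (fun y => derive phi y (eS l)) x (eS k).

Definition locmax (D : set pt) (g : pt -> R) (x : pt) : Prop :=
  D x /\ exists e : R, 0 < e /\ forall y, D y -> `|y - x| < e -> g y <= g x.
Definition locmin (D : set pt) (g : pt -> R) (x : pt) : Prop :=
  D x /\ exists e : R, 0 < e /\ forall y, D y -> `|y - x| < e -> g x <= g y.

Definition subsol (U : 'I_J -> pt -> R) : Prop :=
  (forall j, loc_bounded Dom (U j)) /\
  forall j (phi : pt -> R) x, smooth phi ->
    locmax Dom (fun y => usc_env Dom (U j) y - phi y) x ->
    Flo j x (usc_env Dom (U j) x) (dtau phi x) (gradS phi x) (hessS phi x)
        (\row_k usc_env Dom (U k) x) <= 0.

Definition supersol (U : 'I_J -> pt -> R) : Prop :=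
  (forall j, loc_bounded Dom (U j)) /\
  forall j (phi : pt -> R) x, smooth phi ->
    locmin Dom (fun y => lsc_env Dom (U j) y - phi y) x ->
    0 <= Fup j x (lsc_env Dom (U j) x) (dtau phi x) (gradS phi x) (hessS phi x)
        (\row_k lsc_env Dom (U k) x).

Definition visc_sol (U : 'I_J -> pt -> R) : Prop := subsol U /\ supersol U.

Definition strong_comparison : Prop :=
  forall U V, subsol U -> supersol V ->
    forall j x, Dom x -> usc_env Dom (U j) x <= lsc_env Dom (V j) x.

Definition bdd_lip {V : normedModType R} (g : 'I_J -> pt -> V) : Prop :=
  exists K : R, forall j x y, Dom x -> Dom y ->
    `|g j x| <= K /\ `|g j x - g j y| <= K * `|x - y|.

Definition data_hyp : Prop :=
  [/\ bdd_lip (sigma P), bdd_lip (mu P),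
      bdd_lip (fun j x => rcoef P j x : R^o) & bdd_lip (fun j x => fcoef P j x : R^o)] /\
  [/\ (1 < J)%N, 0 < cost P & 0 < Thor P] /\
  [/\ bounded_set (Om P), closed (Om P), bdh P `<=` Om P &
      bdh P `&` interior (Om P) = set0].

(* ------------------ the discretization (a sequence of grids, index m) ----- *)
Record scheme_data := Scheme {
  hm   : nat -> R;
  dt   : nat -> R;
  Nt   : nat -> nat;
  Nn   : nat -> 'I_J -> nat;
  node : forall m j, 'I_(Nn m j) -> 'rV[R]_d;
  (* interp m k j n v i = value at x^n_{j,i} of the interpolant of the
     grid-k values v (at time n) *)
  interp : forall m (k j : 'I_J) (n : nat), ('I_(Nn m k) -> R) -> 'I_(Nn m j) -> R;
  (* Lh m j t v i = (L^h_{q_j} v)_i, v grid-j values at time tau^t *)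
  Lh   : forall m (j : 'I_J) (t : nat), ('I_(Nn m j) -> R) -> 'I_(Nn m j) -> R;
  usol : forall m j, 'I_(Nn m j) -> nat -> R }.
Arguments node s {m j} i.
Arguments interp s {m} k {j} n v i.
Arguments Lh s {m j} t v i.
Arguments usol s {m j} i t.

Variable Sc : scheme_data.

Definition xnode m j (i : 'I_(Nn Sc m j)) (t : nat) : pt :=
  (node Sc i, t%:R * dt Sc m).

Definition mesh (m : nat) : \bar R :=
  \big[maxe/-oo%E]_(j < J) ereal_sup
     [set \big[mine/+oo%E]_(i < Nn Sc m j) (`|S - node Sc i|)%:E | S in Om P].

(* G_j at node x^t_{j,i} (t = n+1 at interior nodes) with center value c,
   grid-j values v at time t (entry i ignored), old value vo = u^{t-1}_{j,i},
   and interpolated values w_k of the other grids *)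
Definition Gsch m (j : 'I_J) (t : nat) (i : 'I_(Nn Sc m j)) (c : R)
    (v : 'I_(Nn Sc m j) -> R) (vo : R) (w : 'rV[R]_J) : R :=
  if t == 0%N then c - Gini P (node Sc i)
  else if `[< bdh P (node Sc i) >] then c - Bdir P j (xnode i t)
  else let Lv := Lh Sc t (fun a => if a == i then c else v a) i in
       Num.min ((c - vo) / dt Sc m - Lv) (c - maxoth j w - dt Sc m * Lv).

Definition utilde m (k j : 'I_J) (n : nat) (i : 'I_(Nn Sc m j)) : R :=
  interp Sc k n (fun a => usol Sc a n) i.

Definition grid_hyp : Prop :=
  [/\ forall m, 0 < hm Sc m /\ mesh m = (hm Sc m)%:E,
      forall m, 0 < dt Sc m /\ (Nt Sc m)%:R * dt Sc m = Thor P,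
      forall m j (i : 'I_(Nn Sc m j)), Om P (node Sc i),
      hm Sc m @[m --> \oo] --> 0 &
      dt Sc m @[m --> \oo] --> 0].

Definition solves : Prop :=
  forall m j (i : 'I_(Nn Sc m j)) t, (t <= Nt Sc m)%N ->
    Gsch t i (usol Sc i t) (fun a => usol Sc a t) (usol Sc i t.-1)
         (\row_k @utilde m k j t.-1 i) = 0.

(* (C1) positive interpolation on neighbours (nodes within kappa*h) *)
Definition C1 : Prop :=
  exists kappa : R, 0 <= kappa /\
  forall m (k j : 'I_J) n (v : 'I_(Nn Sc m k) -> R) (i : 'I_(Nn Sc m j)),
  exists om : 'I_(Nn Sc m k) -> R,
    [/\ forall a, 0 <= om a, \sum_a om a = 1,
        forall a, om a != 0 -> `|node Sc a - node Sc i| <= kappa * hm Sc m &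
        interp Sc k n v i = \sum_a om a * v a].

Definition C2 : Prop :=
  forall m j t (i : 'I_(Nn Sc m j)) c (v v' : 'I_(Nn Sc m j) -> R) vo vo'
         (w w' : 'rV[R]_J),
    (forall a, a != i -> v a <= v' a) -> vo <= vo' ->
    (forall k, w ord0 k <= w' ord0 k) ->
    Gsch t i c v' vo' w' <= Gsch t i c v vo w.

Definition C3 : Prop :=
  exists Cb : R, forall m j (i : 'I_(Nn Sc m j)) t, (t <= Nt Sc m)%N ->
    `|usol Sc i t| <= Cb.

Definition C4 : Prop :=
  forall (j : 'I_J) (phi : pt -> R), smooth phi ->
  exists om1 om2 : R -> R,
    [/\ om1 h @[h --> 0^'+] --> 0, om2 xi @[xi --> 0] --> 0 &
    forall m (i : 'I_(Nn Sc m j)) t (xi : R) (w : 'rV[R]_J), (t <= Nt Sc m)%N ->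
      let x := xnode i t in
      `| Gsch t i (phi x + xi) (fun a => phi (xnode a t) + xi)
              (phi (xnode i t.-1) + xi) w
         - Fop j x (phi x) (dtau phi x) (gradS phi x) (hessS phi x) w |
      <= om1 (hm Sc m) + om2 xi].

End SwitchingScheme.

Arguments node {R d J} s {m j} i.
Arguments interp {R d J} s {m} k {j} n v i.
Arguments Lh {R d J} s {m j} t v i.
Arguments usol {R d J} s {m j} i t.
Arguments xnode {R d J} Sc {m j} i t.

(* Main.v *)
(* Barles-Souganidis: the upper and lower half-relaxed limits of the grid functions
   are a viscosity sub- and supersolution, so strong comparison makes them coincide,
   which gives both continuity of the limit and uniform convergence.  At a contact
   point weak monotonicity replaces the neighbouring values on grid j by those of the
   test function but keeps the interpolated values of the other components; by
   consistency these enter F_j directly, positive interpolation bounds their limit by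
   the half-relaxed limits, and F_j is nonincreasing in them.  A quartic
   penalty, whose 2-jet vanishes at the contact point, makes the contact strict and
   global. *)
Require Import Defs.
From HB Require Import structures.
From mathcomp Require Import all_boot all_order all_algebra.
From mathcomp Require Import all_classical all_reals all_analysis.
From mathcomp Require Import lra.
Set Implicit Arguments. Unset Strict Implicit.
Import Order.TTheory GRing.Theory Num.Theory.
Import numFieldNormedType.Exports.
Local Open Scope classical_set_scope.
Local Open Scope ring_scope.

(** * Half-relaxed limits of functions on a sequence of finite grids *)

Section HalfRelaxedLimits.
Context {R : realType} {V : normedModType R} (I : nat -> finType).
Variable X : forall m, I m -> V.
Implicit Types (u : forall m, I m -> R) (x : V) (c : R).

Definition evub u x c := exists e N, 0 < e /\
  forall m, (N <= m)%N -> forall i : I m, `|X i - x| < e -> u m i <= c.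

(** The limsup as nodes tend to [x] and the grid index to infinity, taken as a real infimum. For
    bounded [u] and nodes accumulating at [x] the set is nonempty and bounded below, so the default
    value of [inf] does not arise. *)
Definition ulim u x := inf [set c | evub u x c].

Definition llim u x := - ulim (fun m i => - u m i) x.

Variables (D : set V) (C : R) (u : forall m, I m -> R).
Hypothesis Xdense : forall x e, D x -> 0 < e ->
  exists N, forall m, (N <= m)%N -> exists i : I m, `|X i - x| < e.
Hypothesis ubd : forall m (i : I m), `|u i| <= C.

Lemma evub_bound x : evub u x C.
Proof. by exists 1, 0%N; split=> // m _ i _; exact: le_trans (ler_norm _) (ubd _). Qed.

(** Density puts a node into every neighbourhood, so an eventual bound is never vacuous. *)
Lemma evub_lb x c : D x -> evub u x c -> - C <= c.
Proof.
move=> Dx [e [N [e0 H]]]; have [N' H'] := Xdense Dx e0.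
have [i Hi] := H' _ (leq_maxr N N').
have := H _ (leq_maxl N N') i Hi; apply: le_trans.
by have := ubd i; rewrite ler_norml => /andP[].
Qed.

Lemma has_inf_evub x : D x -> has_inf [set c | evub u x c].
Proof.
by move=> Dx; split; [exists C; exact: evub_bound | exists (- C) => c; exact: evub_lb].
Qed.

Lemma ulim_le x c : D x -> evub u x c -> ulim u x <= c.
Proof. by move=> Dx H; apply: ge_inf => //; have [] := has_inf_evub Dx. Qed.

Lemma ulim_ltP x c : D x -> ulim u x < c -> evub u x c.
Proof.
move=> Dx lc; have e0 : 0 < c - ulim u x by rewrite subr_gt0.
have [c' [e [N [he H]]] lt] := inf_adherent e0 (has_inf_evub Dx).
exists e, N; split=> // m Nm i Hi; apply: le_trans (H m Nm i Hi) _.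
by rewrite ltW // (lt_le_trans lt) // -/(ulim u x) addrC subrK.
Qed.

Lemma ulim_bound x : D x -> `|ulim u x| <= C.
Proof.
move=> Dx; rewrite ler_norml ulim_le ?andbT //; last exact: evub_bound.
by apply: lb_le_inf; [have [] := has_inf_evub Dx | move=> c; exact: evub_lb].
Qed.

Lemma ulim_gtP x c e N : D x -> c < ulim u x -> 0 < e ->
  exists m (i : I m), [/\ (N <= m)%N, `|X i - x| < e & c < u i].
Proof.
move=> Dx lc e0; apply: contrapT => H.
suff : ulim u x <= c by rewrite leNgt lc.
apply: ulim_le => //; exists e, N; split=> // m Nm i Hi.
by rewrite leNgt; apply/negP => lt; apply: H; exists m, i.
Qed.

(** A bound on the nodes in the ball of radius [e] about [x] also serves at any [y] of that ball, on
    the remaining radius. *)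
Lemma ulim_usc x c : D x -> ulim u x < c ->
  exists e, 0 < e /\ forall y, D y -> `|y - x| < e -> ulim u y <= c.
Proof.
move=> Dx /(ulim_ltP Dx)[e [N [e0 H]]]; exists e; split=> // y Dy xy.
apply: ulim_le => //; exists (e - `|y - x|), N; split; first by rewrite subr_gt0.
move=> m Nm i Hi; apply: H => //; have := ler_distD y (X i) x; lra.
Qed.

(** A node lying in both neighbourhoods satisfies [- u <= c] and [u <= c'] at once, hence
    [- c <= c']. *)
Lemma llim_le_ulim x : D x -> llim u x <= ulim u x.
Proof.
move=> Dx; rewrite /llim lerNl.
apply: lb_le_inf.
  exists C, 1, 0%N; split=> // m _ i _.
  by have := ubd i; rewrite ler_norml => /andP[]; rewrite lerNl.
move=> c [e [N [e0 H]]]; rewrite lerNl; apply: lb_le_inf; first by have [] := has_inf_evub Dx.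
move=> c' [e' [N' [e'0 H']]].
have m0 : 0 < Num.min e e' by rewrite lt_min e0 e'0.
have [N2 H2] := Xdense Dx m0.
have [i] := H2 (maxn (maxn N N') N2) (leq_maxr _ _).
rewrite lt_min => /andP[h1 h2].
have := H _ _ i h1; have := H' _ _ i h2.
rewrite !leq_max !leqnn !orbT => /(_ isT) + /(_ isT); lra.
Qed.

Hypothesis XD : forall m (i : I m), D (X i).
Hypothesis Dcpt : compact D.

(** Compactness, in its near-covering form, lets one index threshold serve all points of [D]. *)
Lemma near_nodes (Q : forall m, I m -> Prop) :
  (forall x, D x -> exists e N, 0 < e /\
    forall m, (N <= m)%N -> forall i : I m, `|X i - x| < e -> Q m i) ->
  exists N, forall m, (N <= m)%N -> forall i : I m, Q m i.
Proof.
move=> H; have := Dcpt; rewrite compact_near_coveringP.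
(* The property of nodes becomes a property of points by quantifying over all nodes located at
   [y]. *)
move=> /(_ nat \oo (fun m y => forall i : I m, X i = y -> Q m i) _).
case.
- move=> x Dx; have [e [N [e0 He]]] := H x Dx.
  exists (ball x e, [set m | (N <= m)%N]) => /=.
    by split; [exact: nbhsx_ballx | exists N].
  case=> y m /= [xy Nm] i Xi; apply: He => //.
  by rewrite Xi; move: xy; rewrite -ball_normE /= distrC.
- by move=> N _ HN; exists N => m Nm i; exact: (HN m Nm (X i)).
Qed.

(* The penalised grid maximisers converge to a strict maximum point, together with their values. *)
Lemma grid_touch (psi : V -> R) x e N :
  D x -> continuous psi -> psi x = ulim u x ->
  (forall rho, 0 < rho -> exists eta, 0 < eta /\
     forall y, D y -> rho <= `|y - x| -> ulim u y + eta <= psi y) ->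
  0 < e ->
  exists m (i : I m), [/\ (N <= m)%N, `|X i - x| < e, `|u i - psi (X i)| < e &
    forall a : I m, u a - psi (X a) <= u i - psi (X i)].
Proof.
move=> Dx cpsi psix H e0; have [eta [eta0 Heta]] := H e e0.
have le_psi y : D y -> ulim u y <= psi y.
  move=> Dy; have [->|yx] := eqVneq y x; first by rewrite psix.
  have [|n [n0 Hn]] := H `|y - x|; first by rewrite normr_gt0 subr_eq0.
  by apply: le_trans (Hn y Dy (lexx _)); rewrite lerDl ltW.
(* The bound [e / 2] keeps every gap [u - psi] below [2 * th <= e]. The bound [eta / 8] lets a gap
   above [- 3 / 2 * th], available near [x], beat the far nodes, whose gaps lie below
   [- (eta / 4)]. *)
pose th := Num.min (e / 2) (eta / 8).
have th0 : 0 < th by rewrite lt_min !divr_gt0.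
have [the tht] : th <= e / 2 /\ th <= eta / 8 by rewrite !ge_min !lexx !orbT.
have contpsi y : exists r, 0 < r /\ forall z, `|z - y| < r -> `|psi z - psi y| < th.
  have : nbhs (psi y) (ball (psi y) th) by exact: nbhsx_ballx.
  move=> /cpsi /nbhs_ballP[r r0 hr]; exists r; split=> // z zy.
  have : ball y r z by rewrite -ball_normE /= distrC.
  by move=> /hr; rewrite /= -ball_normE /= distrC.
have [N1 HN1] : exists N, forall m, (N <= m)%N -> forall i : I m,
    u i - psi (X i) < e.
  apply: near_nodes => y Dy; have [r [r0 Hr]] := contpsi y.
  have : ulim u y < psi y + th by rewrite (le_lt_trans (le_psi _ Dy)) // ltrDl.
  move=> /(ulim_ltP Dy)[s [N' [s0 Hs]]].
  exists (Num.min r s), N'; split; first by rewrite lt_min r0 s0.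
  move=> m Nm i; rewrite lt_min => /andP[hr hs].
  have := Hs _ Nm i hs; have := Hr _ hr; rewrite ltr_norml => /andP[? ?] ?.
  by lra.
have [N2 HN2] : exists N, forall m, (N <= m)%N -> forall i : I m,
    e <= `|X i - x| -> u i - psi (X i) < - (eta / 4).
  apply: near_nodes => y Dy; have [r [r0 Hr]] := contpsi y.
  have [ye|ye] := ltP `|y - x| e.
    (* This ball stays within distance [e] of [x], so the premise on far nodes fails there. *)
    exists (e - `|y - x|), 0%N; split; first by rewrite subr_gt0.
    by move=> m _ i Xy ee; have := ler_distD y (X i) x; lra.
  have : ulim u y < psi y - eta / 2 by have := Heta y Dy ye; lra.
  move=> /(ulim_ltP Dy)[s [N' [s0 Hs]]].
  exists (Num.min r s), N'; split; first by rewrite lt_min r0 s0.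
  move=> m Nm i; rewrite lt_min => /andP[hr hs] _.
  have := Hs _ Nm i hs; have := Hr _ hr; rewrite ltr_norml => /andP[? ?] ?.
  by lra.
have [r [r0 Hr]] := contpsi x.
have lt : ulim u x - th / 2 < ulim u x by rewrite ltrBlDr ltrDl divr_gt0.
(* A node near [x] that almost attains the upper limit; the grid maximiser can only have a larger
   gap, which forces it to be near [x] too. *)
have [m [i0 [Nm Xi0 ui0]]] := ulim_gtP (maxn N (maxn N1 N2)) Dx lt r0.
move: Nm; rewrite !geq_max => /and3P[Nm N1m N2m].
have := Hr _ Xi0; rewrite ltr_norml psix => /andP[h1 h2].
pose g (a : I m) := u a - psi (X a).
have [i _ Hi] : exists2 i, true & forall a, g a <= g i.
  by case: (@Order.TotalTheory.arg_maxP _ _ _ i0 xpredT g isT) => i _ Hi; exists i => // a; exact: Hi.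
exists m, i; split=> //.
- rewrite ltNge; apply/negP => /(HN2 _ N2m); have := Hi i0; rewrite /g; lra.
- rewrite ltr_norml (HN1 m N1m i) andbT.
  by have := Hi i0; rewrite /g; lra.
Qed.

End HalfRelaxedLimits.

(** * Semicontinuous envelopes relative to a domain *)

Section Envelopes.
Context {R : realType} {d : nat}.
Local Notation pt := (@pt R d).
Variable D : set pt.
Implicit Types (f g : pt -> R) (x : pt) (c e : R).

(** The envelope before [fine]. Bounding it on both sides shows it finite, so [fine] does not return
    its default 0. *)
Let usc_e f x : \bar R := ereal_inf
  [set ereal_sup [set (f y)%:E | y in D `&` [set y | `|y - x| < e]]
  | e in [set e : R | 0 < e]].

Let usc_e_ge f x : D x -> ((f x)%:E <= usc_e f x)%E.
Proof.
move=> Dx; apply: le_ereal_inf_tmp => _ [e /= e0 <-].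
by apply: ereal_sup_ubound; exists x => //; split=> //=; rewrite subrr normr0.
Qed.

Let usc_e_le f x c e : 0 < e -> (forall y, D y -> `|y - x| < e -> f y <= c) ->
  (usc_e f x <= c%:E)%E.
Proof.
move=> e0 H; apply: ge_ereal_inf; eexists; first by exists e.
by apply: ge_ereal_sup => _ [y [Dy /= xy] <-]; rewrite lee_fin H.
Qed.

Lemma usc_env_ge f x : loc_bounded D f -> D x -> f x <= usc_env D f x.
Proof.
move=> bf Dx; have [e [M [e0 H]]] := bf x Dx.
have : (usc_e f x <= M%:E)%E.
  by apply: (usc_e_le e0) => y Dy xy; rewrite (le_trans (ler_norm _)) ?H.
have := usc_e_ge f Dx; rewrite /usc_env -/(usc_e f x).
by case: (usc_e f x) => //= r; rewrite lee_fin.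
Qed.

Lemma usc_env_le f x c e : D x -> 0 < e ->
  (forall y, D y -> `|y - x| < e -> f y <= c) -> usc_env D f x <= c.
Proof.
move=> Dx e0 H; have := usc_e_le e0 H; have := usc_e_ge f Dx.
by rewrite /usc_env -/(usc_e f x); case: (usc_e f x) => //= r _; rewrite lee_fin.
Qed.

Lemma usc_env_id f x : loc_bounded D f -> D x ->
  (forall c, f x < c -> exists e, 0 < e /\
    forall y, D y -> `|y - x| < e -> f y <= c) ->
  usc_env D f x = f x.
Proof.
move=> bf Dx H; apply/eqP; rewrite eq_le usc_env_ge // andbT.
apply/ler_addgt0Pr => e e0; have [|r [r0 Hr]] := H (f x + e); first by rewrite ltrDl.
exact: usc_env_le Hr.
Qed.

(** Carries the facts on upper envelopes over to lower ones. *)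
Lemma lsc_envN f x : lsc_env D f x = - usc_env D (fun y => - f y) x.
Proof.
rewrite /lsc_env /usc_env -fineN; congr fine; rewrite -ereal_supN; congr ereal_sup.
rewrite image_comp; apply: eq_imagel => e /= _.
rewrite -ereal_infN; congr ereal_inf; rewrite image_comp.
by apply: eq_imagel => y _ /=; rewrite opprK.
Qed.

Lemma eq_usc_env f g x : (forall y, D y -> f y = g y) -> usc_env D f x = usc_env D g x.
Proof.
move=> fg; congr fine; congr ereal_inf; apply: eq_imagel => e _.
by congr ereal_sup; apply: eq_imagel => y [Dy _]; rewrite fg.
Qed.

Lemma eq_lsc_env f g x : (forall y, D y -> f y = g y) -> lsc_env D f x = lsc_env D g x.
Proof. by move=> fg; rewrite !lsc_envN; congr (- _); apply: eq_usc_env => y /fg ->. Qed.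

Lemma loc_boundedN f : loc_bounded D f -> loc_bounded D (fun y => - f y).
Proof.
move=> H x /H[e [M [e0 HM]]]; exists e, M; split=> // y Dy xy.
by rewrite normrN HM.
Qed.

Lemma lsc_env_le f x : loc_bounded D f -> D x -> lsc_env D f x <= f x.
Proof. by move=> /loc_boundedN bf Dx; rewrite lsc_envN lerNl; exact: usc_env_ge bf Dx. Qed.

End Envelopes.

(** * Sign criteria for [Flo] and [Fup], and monotonicity of [Fop] in the coupling *)

Section RelaxedHamiltonian.
Context {R : realType} {d J : nat} (P : @pde_data R d J).
Variables (j : 'I_J) (x : @pt R d) (r q : R) (p : 'rV[R]_d) (M : 'M[R]_d) (w : 'rV[R]_J).

(** Nearby arguments with values at most [e] make every inner infimum nonpositive, hence also their
    supremum; [fine] keeps this sign even at an infinite value. *)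
Lemma Flo_le0 : (forall e, 0 < e -> exists y r' q' p' M' w',
    nearF P e x r q p M w y r' q' p' M' w' /\ Fop P j y r' q' p' M' w' <= e) ->
  Flo P j x r q p M w <= 0.
Proof.
move=> H; rewrite /Flo; apply: fine_le0; apply: ge_ereal_sup => _ [e /= e0 <-].
apply/lee_addgt0Pr => d' d0; rewrite add0e.
(* One tolerance serves both as radius of the neighbourhood and as error in the value. *)
have m0 : 0 < Num.min e d' by rewrite lt_min e0.
have [y [r' [q' [p' [M' [w' [[[Dy h1 h2 h3] [h4 h5 h6]] HF]]]]]]] := H _ m0.
apply: (@le_trans _ _ (Fop P j y r' q' p' M' w')%:E); last first.
  by rewrite lee_fin (le_trans HF) // ge_min lexx orbT.
apply: ereal_inf_lbound; exists y, r', q', p', M', w'; split=> //.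
by move: h1 h2 h3 h4 h5 h6; rewrite !lt_min => /andP[? _] /andP[? _] /andP[? _]
  /andP[? _] /andP[? _] /andP[? _].
Qed.

Lemma Fup_ge0 : (forall e, 0 < e -> exists y r' q' p' M' w',
    nearF P e x r q p M w y r' q' p' M' w' /\ - e <= Fop P j y r' q' p' M' w') ->
  0 <= Fup P j x r q p M w.
Proof.
move=> H; rewrite /Fup; apply: fine_ge0; apply: le_ereal_inf_tmp => _ [e /= e0 <-].
apply/lee_addgt0Pr => d' d0.
have m0 : 0 < Num.min e d' by rewrite lt_min e0.
have [y [r' [q' [p' [M' [w' [[[Dy h1 h2 h3] [h4 h5 h6]] HF]]]]]]] := H _ m0.
rewrite -leeBlDr // sub0e; apply: (@le_trans _ _ (Fop P j y r' q' p' M' w')%:E).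
  by rewrite -EFinN lee_fin (le_trans _ HF) // lerN2 ge_min lexx orbT.
apply: ereal_sup_ubound; exists y, r', q', p', M', w'; split=> //.
by move: h1 h2 h3 h4 h5 h6; rewrite !lt_min => /andP[? _] /andP[? _] /andP[? _]
  /andP[? _] /andP[? _] /andP[? _].
Qed.

Lemma maxoth_le (w' : 'rV[R]_J) : (forall k, w ord0 k <= w' ord0 k) ->
  maxoth P j w <= maxoth P j w'.
Proof.
move=> ww; rewrite /maxoth; case: pickP => // k0 k0j.
have le k : w ord0 k - cost P <= w' ord0 k - cost P by rewrite lerB.
apply: (big_ind2 (fun a b => a <= b)) => // a b a' b' ab ab'.
by rewrite ge_max !le_max ab ab' orbT.
Qed.

Lemma Fop_le (w' : 'rV[R]_J) : (forall k, w ord0 k <= w' ord0 k) ->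
  Fop P j x r q p M w' <= Fop P j x r q p M w.
Proof.
move=> /maxoth_le ww; rewrite /Fop; case: ifP => // _; case: ifP => // _.
by have h := lerB (lexx r) ww; rewrite le_min !ge_min lexx h orbT.
Qed.

End RelaxedHamiltonian.

(** * Calculus of smooth test functions, the penalty and strict touching *)

Section SmoothFunctions.
Context {R : realType} {d : nat}.
Local Notation pt := (@pt R d).
Implicit Types (f g phi : pt -> R) (x y v : pt) (c : R) (n : nat).

Lemma smooth_nW n f : smooth_n n.+1 f -> smooth_n n f.
Proof.
elim: n f => [//|n IH] f [df Hf]; split=> // v; exact/IH/Hf.
Qed.

Lemma smooth_n_cst n c : smooth_n n (fun _ : pt => c).
Proof.
elim: n c => [//|n IH] c; split=> [x|v]; first exact: differentiable_cst.
have -> : (fun y => derive (fun _ : pt => c) y v) = fun _ => 0.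
  by apply/funext => y; exact: derive_cst.
exact: IH.
Qed.

Lemma smooth_nD n f g : smooth_n n f -> smooth_n n g ->
  smooth_n n (fun y => f y + g y).
Proof.
elim: n f g => [//|n IH] f g [df Hf] [dg Hg]; split=> [x|v].
  exact: (differentiableD (df x) (dg x)).
have -> : (fun y => derive (fun y => f y + g y) y v) =
          (fun y => derive f y v + derive g y v).
  by apply/funext => y; apply: deriveD; apply: diff_derivable.
by apply: IH; [exact: Hf | exact: Hg].
Qed.

Lemma deriveMfun f g v : (forall x, differentiable f x) -> (forall x, differentiable g x) ->
  (fun y => derive (fun y => f y * g y) y v) =
  (fun y => f y * derive g y v + g y * derive f y v).
Proof. by move=> df dg; apply/funext => y; apply: deriveM; apply: diff_derivable. Qed.

(** Leibniz terms pair a derivative with an undifferentiated factor, which [smooth_nW] brings down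
    to the same order. *)
Lemma smooth_nM n f g : smooth_n n f -> smooth_n n g ->
  smooth_n n (fun y => f y * g y).
Proof.
elim: n f g => [//|n IH] f g Sf Sg; have [df Hf] := Sf; have [dg Hg] := Sg.
split=> [x|v]; first exact: (differentiableM (df x) (dg x)).
rewrite deriveMfun //; apply: smooth_nD; apply: IH;
  by [exact: smooth_nW | exact: Hf | exact: Hg].
Qed.

Lemma smooth_cst c : smooth (fun _ : pt => c).
Proof. by move=> n; exact: smooth_n_cst. Qed.

Lemma smoothD f g : smooth f -> smooth g -> smooth (fun y => f y + g y).
Proof. by move=> sf sg n; exact: smooth_nD. Qed.

Lemma smoothM f g : smooth f -> smooth g -> smooth (fun y => f y * g y).
Proof. by move=> sf sg n; exact: smooth_nM. Qed.

Lemma smooth_diff f x : smooth f -> differentiable f x.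
Proof. by move=> /(_ 1%N)[]. Qed.

Lemma smooth_derive f v : smooth f -> smooth (fun y => derive f y v).
Proof. by move=> sf n; have [_ H] := sf n.+1; exact: H. Qed.

Lemma smooth_cont f : smooth f -> continuous f.
Proof. by move=> sf x; exact/differentiable_continuous/smooth_diff. Qed.

(** The directional derivative of a linear map does not depend on the base point. *)
Lemma smooth_lin (f : {linear pt -> R}) : continuous f -> smooth f.
Proof.
move=> cf [//|n]; split=> [x|v]; first exact: linear_differentiable.
have -> : (fun y => derive f y v) = fun _ => f v.
  apply/funext => y; rewrite deriveE; last exact: linear_differentiable.
  by rewrite diff_lin.
exact: smooth_n_cst.
Qed.

Lemma smooth_time c : smooth (fun y : pt => y.2 - c).
Proof.
apply: smoothD; last exact: smooth_cst.
have lin : linear (fun y : pt => y.2) by [].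
pose fM := GRing.isLinear.Build R pt R _ _ lin.
pose f : {linear pt -> R} := HB.pack (fun y : pt => y.2) fM.
by apply: (@smooth_lin f) => y; exact: cvg_snd.
Qed.

Lemma smooth_coord k c : smooth (fun y : pt => y.1 ord0 k - c).
Proof.
apply: smoothD; last exact: smooth_cst.
have lin : linear (fun y : pt => y.1 ord0 k) by move=> a u v; rewrite !mxE.
pose fM := GRing.isLinear.Build R pt R _ _ lin.
pose f : {linear pt -> R} := HB.pack (fun y : pt => y.1 ord0 k) fM.
apply: (@smooth_lin f) => y.
apply: (@continuous_comp _ _ _ fst (fun u : 'rV[R]_d => u ord0 k)); first exact: cvg_fst.
exact: coord_continuous.
Qed.

Lemma derive_addfun f g x v : smooth f -> smooth g ->
  derive (fun y => f y + g y) x v = derive f x v + derive g x v.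
Proof. by move=> sf sg; apply: deriveD; exact/diff_derivable/smooth_diff. Qed.

Lemma derive_mulfun f g x v : smooth f -> smooth g ->
  derive (fun y => f y * g y) x v = f x * derive g x v + g x * derive f x v.
Proof. by move=> sf sg; apply: deriveM; exact/diff_derivable/smooth_diff. Qed.

Lemma derive_scalefun c f x v : smooth f ->
  derive (fun y => c * f y) x v = c * derive f x v.
Proof.
move=> sf; rewrite derive_mulfun //; last exact: smooth_cst.
have -> : derive (fun _ : pt => c) x v = 0 by exact: derive_cst.
by rewrite mulr0 addr0.
Qed.

(** Vanishing to first order; the square of such a function has a zero 2-jet at [x]. *)
Definition flat1 f x := [/\ smooth f, f x = 0 & forall v, derive f x v = 0].

Lemma flat1D f g x : flat1 f x -> flat1 g x -> flat1 (fun y => f y + g y) x.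
Proof.
move=> [sf f0 f1] [sg g0 g1]; split=> [||v]; first exact: smoothD.
  by rewrite f0 g0 addr0.
by rewrite derive_addfun // f1 g1 addr0.
Qed.

Lemma flat1_sum m (F : 'I_m -> pt -> R) x : (forall k, flat1 (F k) x) ->
  flat1 (fun y => \sum_(k < m) F k y) x.
Proof.
elim: m F => [|m IH] F HF.
  rewrite (_ : (fun y => _) = fun=> 0); last by apply/funext => y; rewrite big_ord0.
  by split=> // [|v]; [exact: smooth_cst | exact: derive_cst].
rewrite (_ : (fun y => _) = fun y => F ord0 y + \sum_(k < m) F (lift ord0 k) y).
  by apply: flat1D => //; apply: IH.
by apply/funext => y; rewrite big_ord_recl.
Qed.

Lemma flat1_sqr f x : smooth f -> f x = 0 -> flat1 (fun y => f y * f y) x.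
Proof.
move=> sf f0; split=> [||v]; first exact: smoothM.
  by rewrite f0 mulr0.
by rewrite derive_mulfun // f0 !mul0r addr0.
Qed.

(** The witness is the square of the squared Euclidean distance [Q]. Every term of its first and
    second derivatives keeps a factor [Q] or a first derivative of [Q], both zero at [x]; and [Q]
    dominates the square of the max norm of [pt]. *)
Lemma penalty_exists x : exists q : pt -> R, [/\ smooth q, q x = 0,
  forall v, derive q x v = 0, forall u v, derive (fun y => derive q y u) x v = 0 &
  forall y, `|y - x| ^+ 4 <= q y].
Proof.
pose S y := \sum_(k < d) (y.1 ord0 k - x.1 ord0 k) * (y.1 ord0 k - x.1 ord0 k).
pose Q (y : pt) := S y + (y.2 - x.2) * (y.2 - x.2).
have [sQ Q0 Q1] : flat1 Q x.
  apply: flat1D; last by apply: flat1_sqr; [exact: smooth_time | rewrite subrr].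
  by apply: flat1_sum => k; apply: flat1_sqr; [exact: smooth_coord | rewrite subrr].
exists (fun y => Q y * Q y); split.
- exact: smoothM.
- by rewrite Q0 mulr0.
- by move=> v; rewrite derive_mulfun // Q0 !mul0r addr0.
- move=> u v; rewrite deriveMfun; try by move=> y; exact: smooth_diff.
  have sQu : smooth (fun y => derive Q y u) by exact: smooth_derive.
  by rewrite derive_addfun ?derive_mulfun ?Q0 ?Q1 ?mul0r ?addr0 //; exact: smoothM.
- move=> y; have S0 : 0 <= S y by apply: sumr_ge0 => k _; rewrite -expr2 sqr_ge0.
  suff H : `|y - x| ^+ 2 <= Q y.
    by rewrite (exprM _ 2 2) -expr2 lerXn2r ?nnegrE ?exprn_ge0 ?(le_trans _ H).
  have t0 : 0 <= (y.2 - x.2) * (y.2 - x.2) by rewrite -expr2 sqr_ge0.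
  rewrite prod_normE; case: (leP `|(y - x).1| `|(y - x).2|) => _.
    by rewrite real_normK ?num_real // expr2 lerDr.
  (* A nonzero matrix norm is attained at an entry, whose square is one summand of [S]. *)
  have [E|/mx_norm_neq0[[i k]]] := eqVneq (mx_norm (y - x).1) 0.
    have -> : `|(y - x).1| = 0 by exact: E.
    by rewrite expr0n /= addr_ge0.
  rewrite /= ord1 => E.
  have -> : `|(y - x).1| = `|(y - x).1 ord0 k| by exact: E.
  rewrite real_normK ?num_real // !mxE expr2 ler_wpDr //.
  rewrite /S (bigD1 k) //= lerDl; apply: sumr_ge0 => l _.
  by rewrite -expr2 sqr_ge0.
Qed.

(** Adding [K * q + s] to [phi] keeps its derivatives up to order two at [x], and [s] equalises the
    values there. Inside the ball of local maximality the penalty gives the separation; outside it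
    outweighs the bounds on [f] and [phi]. *)
Lemma strict_touch (D : set pt) (f phi : pt -> R) (C : R) x :
  compact D -> (forall y, D y -> `|f y| <= C) -> smooth phi ->
  locmax D (fun y => f y - phi y) x ->
  exists psi : pt -> R, [/\ smooth psi, psi x = f x,
    forall v, derive psi x v = derive phi x v,
    forall u v, derive (fun y => derive psi y u) x v
              = derive (fun y => derive phi y u) x v &
    forall rho, 0 < rho -> exists eta, 0 < eta /\
      forall y, D y -> rho <= `|y - x| -> f y + eta <= psi y].
Proof.
move=> Dcpt fC sphi [Dx [e [e0 He]]].
have [B HB] : exists B, forall y, D y -> `|phi y| <= B.
  have /compact_bounded[M [_ HM]] : compact (phi @` D).
    apply: continuous_compact => //; apply: continuous_subspaceT; exact: smooth_cont.
  by exists (M + 1) => y Dy; apply: HM; [rewrite ltrDl | exists y].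
have [q [sq q0 q1 q2 qge]] := penalty_exists x.
(* At distance [e] or more, [K * q] covers the oscillation [2 * C] of [f], the oscillation [2 * B]
   of [phi] and a margin 1. *)
pose K := (2 * C + 2 * B + 1) / e ^+ 4; pose s := f x - phi x.
have C0 : 0 <= C by exact: le_trans (fC _ Dx).
have B0 : 0 <= B by exact: le_trans (HB _ Dx).
have e4 : 0 < e ^+ 4 by rewrite exprn_gt0.
have K0 : 0 < K by rewrite divr_gt0 //; lra.
have KE : K * e ^+ 4 = 2 * C + 2 * B + 1 by rewrite /K divfK ?gt_eqF.
clearbody K.
have sKq : smooth (fun y => K * q y) by apply: smoothM => //; exact: smooth_cst.
have sKqs : smooth (fun y => K * q y + s) by apply: smoothD => //; exact: smooth_cst.
have dKqs u y : derive (fun y => K * q y + s) y u = K * derive q y u.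
  rewrite derive_addfun //; last exact: smooth_cst.
  have -> : derive (fun _ : pt => s) y u = 0 by exact: derive_cst.
  by rewrite derive_scalefun // addr0.
exists (fun y => phi y + (K * q y + s)); split.
- exact: smoothD.
- by rewrite q0 mulr0 add0r /s addrC subrK.
- by move=> v; rewrite derive_addfun // dKqs q1 mulr0 addr0.
- move=> u v; have -> : (fun y => derive (fun y => phi y + (K * q y + s)) y u) =
      fun y => derive phi y u + K * derive q y u.
    by apply/funext => y; rewrite derive_addfun // dKqs.
  have ? := smooth_derive u sphi; have ? := smooth_derive u sq.
  have ? := smooth_cst K.
  by rewrite derive_addfun ?derive_scalefun ?q2 ?mulr0 ?addr0 //; exact: smoothM.
(* The margin is [K * rho ^+ 4] within distance [e] of [x] and 1 beyond. *)
move=> rho rho0; exists (Num.min 1 (K * rho ^+ 4)); split.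
  by rewrite lt_min ltr01 mulr_gt0 ?exprn_gt0.
move=> y Dy rhoy.
have pw r : 0 < r -> r <= `|y - x| -> K * r ^+ 4 <= K * q y.
  move=> r0 ry; rewrite ler_pM2l //; apply: le_trans (qge y).
  by rewrite lerXn2r ?nnegrE ?normr_ge0 ?(ltW r0).
have [ye|ye] := ltP `|y - x| e.
  have := He y Dy ye; have := pw _ rho0 rhoy.
  have : Num.min 1 (K * rho ^+ 4) <= K * rho ^+ 4 by rewrite ge_min lexx orbT.
  by rewrite /s; lra.
have := pw _ e0 ye; rewrite KE.
have : Num.min 1 (K * rho ^+ 4) <= 1 by rewrite ge_min lexx.
have := fC _ Dx; have := fC _ Dy; have := HB _ Dx; have := HB _ Dy.
by rewrite !ler_norml /s => /andP[? ?] /andP[? ?] /andP[? ?] /andP[? ?]; lra.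
Qed.

Lemma mx_norm_lt m n (A : 'M[R]_(m, n)) e : 0 < e ->
  (forall i k, `|A i k| < e) -> `|A| < e.
Proof.
move=> e0 H; have -> : `|A| = mx_norm A by [].
rewrite mx_normrE.
by apply: bigmax_lt => // -[i k] _; exact: H.
Qed.

Lemma cvg_near_dist f x e : continuous f -> 0 < e ->
  \forall y \near x, `|f y - f x| < e.
Proof.
move=> cf e0; have : nbhs (f x) (ball (f x) e) by exact: nbhsx_ballx.
move=> /(cf x) /nbhs_ballP[r r0 hr]; apply/nbhs_ballP; exists r => // y /hr.
by rewrite /= -ball_normE /= distrC.
Qed.

Lemma gradS_near f x e : smooth f -> 0 < e ->
  \forall y \near x, `|gradS f y - gradS f x| < e.
Proof.
move=> sf e0; have H (k : 'I_d) : \forall y \near x,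
    `|derive f y (eS k) - derive f x (eS k)| < e.
  by apply: cvg_near_dist => //; exact/smooth_cont/smooth_derive.
have /filter_forall := H; apply: filterS => y Hy.
by apply: mx_norm_lt => // i k; rewrite !mxE.
Qed.

Lemma hessS_near f x e : smooth f -> 0 < e ->
  \forall y \near x, `|hessS f y - hessS f x| < e.
Proof.
move=> sf e0; have H (kl : 'I_d * 'I_d) : \forall y \near x,
    `|derive (fun z => derive f z (eS kl.2)) y (eS kl.1)
      - derive (fun z => derive f z (eS kl.2)) x (eS kl.1)| < e.
  by apply: cvg_near_dist => //; exact/smooth_cont/smooth_derive/smooth_derive.
have /filter_forall := H; apply: filterS => y Hy.
by apply: mx_norm_lt => // i k; rewrite !mxE; exact: (Hy (i, k)).
Qed.

End SmoothFunctions.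

(** * Grid geometry, interpolated values and contact nodes *)

Section Scheme.
Context {R : realType} {d J : nat} (P : @pde_data R d J) (Sc : @scheme_data R d J).
Hypotheses (Pdata : data_hyp P) (grids : grid_hyp P Sc).

(** Space-time nodes up to the horizon form a finite type, so grid maxima are attained. *)
Definition gidx (j : 'I_J) (m : nat) : finType := ('I_(Nn Sc m j) * 'I_(Nt Sc m).+1)%type.
Definition gpt j m (a : gidx j m) : @pt R d := xnode Sc a.1 a.2.
(** The sign [s], equal to 1 or -1, lets one argument treat the upper and the lower limit. *)
Definition gval (s : R) j m (a : gidx j m) : R := s * usol Sc a.1 a.2.

Lemma Dom_xnode m j (i : 'I_(Nn Sc m j)) t : (t <= Nt Sc m)%N -> Dom P (xnode Sc i t).
Proof.
have [_ Hdt Hnode _ _] := grids; have [dt0 TE] := Hdt m => tN.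
split; first exact: Hnode.
by rewrite /= mulr_ge0 ?ler0n ?(ltW dt0) // -TE ler_pM2r // ler_nat.
Qed.

Lemma Dom_compact : compact (Dom P).
Proof.
have [_ [_ [Obd Ocl _ _]]] := Pdata.
have -> : Dom P = Om P `*` `[0, Thor P].
  by apply/seteqP; split=> -[S t] /=; rewrite in_itv.
by apply: compact_setX; [exact: bounded_closed_compact | exact: segment_compact].
Qed.

Lemma near_node m (S : 'rV[R]_d) j : Om P S ->
  exists i : 'I_(Nn Sc m j), `|S - node Sc i| <= hm Sc m.
Proof.
move=> OS; have [/(_ m)[h0 meshE] _ _ _ _] := grids.
have le : (\big[mine/+oo%E]_(i < Nn Sc m j) (`|S - node Sc i|)%:E <= (hm Sc m)%:E)%E.
  rewrite -meshE /mesh.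
  apply: le_trans (le_bigmax _ (fun j => ereal_sup
    [set \big[mine/+oo%E]_(i < Nn Sc m j) (`|S - node Sc i|)%:E
      | S in Om P]) j).
  by apply: ereal_sup_ubound; exists S.
(* If all nodes were farther away the minimum would exceed [hm]; so does its default [+oo], which
   rules out an empty grid. *)
apply: contrapT => H; move: le; rewrite leNgt => /negP; apply.
apply: lt_bigmin; first exact: ltry.
move=> i _; rewrite lte_fin ltNge; apply/negP => Hi; apply: H; by exists i.
Qed.

(** Interpolated data live on the preceding time level, which costs one time step. *)
Lemma dist_xnode m j k (i : 'I_(Nn Sc m j)) (i' : 'I_(Nn Sc m k)) t x :
  `|xnode Sc i' t.-1 - x| <= `|node Sc i' - node Sc i| + dt Sc m + `|xnode Sc i t - x|.
Proof.
have [_ Hdt _ _ _] := grids; have [dt0 _] := Hdt m.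
apply: le_trans (ler_distD (xnode Sc i t) _ _) _; rewrite lerD2r.
rewrite prod_normE /= ge_max; apply/andP; split; first by rewrite lerDl ltW.
rewrite -mulrBl normrM (gtr0_norm dt0).
(* At [t = 0] the predecessor is 0 itself and no time shift occurs. *)
case: t => [|t] /=; first by rewrite subrr normr0 mul0r addr_ge0 // ltW.
by rewrite -natr1 opprD addrA subrr sub0r normrN1 mul1r lerDr.
Qed.

Lemma gpt_dense j x e : Dom P x -> 0 < e -> exists N, forall m, (N <= m)%N ->
  exists a : gidx j m, `|gpt a - x| < e.
Proof.
move=> [Ox /andP[t0 tT]] e0; have [_ Hdt _ hlim dtlim] := grids.
have [N _ HN] : \forall m \near \oo, hm Sc m < e /\ dt Sc m < e.
  by near=> m; split; near: m; exact: (cvgr_lt (0 : R)).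
exists N => m /HN /= [he de]; have [dt0 TE] := Hdt m.
have [i Hi] := near_node m j Ox.
(* The last time level not after [x.2]; it stays within the horizon because [Nt] steps reach [Thor]
   exactly. *)
pose t := Num.truncn (x.2 / dt Sc m).
have /andP[t1 t2] := truncn_itv (divr_ge0 t0 (ltW dt0)).
rewrite -/t in t1 t2; rewrite ler_pdivlMr // in t1; rewrite ltr_pdivrMr // in t2.
have tN : (t < (Nt Sc m).+1)%N.
  by rewrite ltnS -(ler_nat R) -(ler_pM2r dt0) TE (le_trans t1).
exists (i, Ordinal tN); rewrite /gpt /xnode prod_normE /= gt_max.
rewrite distrC (le_lt_trans Hi he) /= distrC ger0_norm ?subr_ge0 //.
rewrite (le_lt_trans _ de) //.
by move: t2; rewrite -natr1 mulrDl mul1r; lra.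
Unshelve. all: by end_near. Qed.

Hypotheses (interpP : C1 Sc) (stable : C3 Sc).

Lemma gval_bound s : exists C, forall j m (a : gidx j m), `|gval s a| <= C.
Proof.
have [C HC] := stable; exists (`|s| * C) => j m a.
by rewrite normrM ler_wpM2l // HC // -ltnS.
Qed.

(** An interpolated value is a convex combination of nodal values near [x], each eventually at most
    [c]. The single index [n] sets both grid threshold and radius, so finitely many components can
    share one. *)
Lemma interp_near s (k : 'I_J) x c : Dom P x -> ulim (@gpt k) (@gval s k) x < c ->
  \forall n \near \oo, forall m, (n <= m)%N ->
    forall j (i : 'I_(Nn Sc m j)) t, (t <= Nt Sc m)%N ->
    `|xnode Sc i t - x| < n.+1%:R^-1 -> s * utilde k t.-1 i <= c.
Proof.
move=> Dx; have [C HC] := gval_bound s.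
move=> /(ulim_ltP (@gpt_dense k) (HC k) Dx)[e [N [e0 He]]].
have [kappa [kappa0 Hk]] := interpP; have [_ _ _ hlim dtlim] := grids.
have e4 : 0 < e / 4 by rewrite divr_gt0.
have klim : kappa * hm Sc m @[m --> \oo] --> (0 : R).
  by rewrite -[X in _ --> X](mulr0 kappa); apply: cvgMr.
have [N' _ HN'] : \forall m \near \oo, kappa * hm Sc m < e / 4 /\ dt Sc m < e / 4.
  by near=> m; split; near: m; exact: (cvgr_lt (0 : R)).
near=> n => m nm j i t tN xi.
have Nm : (N <= m)%N by apply: leq_trans nm; near: n; exact: nbhs_infty_ge.
have N'm : (N' <= m)%N by apply: leq_trans nm; near: n; exact: nbhs_infty_ge.
have ne : n.+1%:R^-1 < e / 4 by near: n; exact: (near_infty_natSinv_lt (PosNum e4)).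
have [hk hdt] := HN' m N'm.
rewrite /utilde; have [om [om0 om1 omn ->]] := Hk m k j t.-1 (fun a => usol Sc a t.-1) i.
have -> : c = \sum_a om a * c by rewrite -mulr_suml om1 mul1r.
rewrite mulr_sumr; apply: ler_sum => a _; rewrite mulrCA.
(* Only nodes of nonzero weight are known to be close to the interpolation point. *)
have [->|oma] := eqVneq (om a) 0; first by rewrite !mul0r.
apply: ler_wpM2l => //.
have tN' : (t.-1 < (Nt Sc m).+1)%N by rewrite ltnS (leq_trans (leq_pred t)).
have := He m Nm (a, Ordinal tN'); apply.
apply: le_lt_trans (dist_xnode i a t x) _.
have xe := lt_trans xi ne; have ke := le_lt_trans (omn a oma) hk.
by lra.
Unshelve. all: by end_near. Qed.

Hypothesis consistent : C4 P Sc.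

(* With [s = 1] (resp. [s = -1]) the test function touches the upper (resp. lower)
   half-relaxed limit; [v] and [vo] are its grid values, shifted to agree with the
   discrete solution at the contact node. *)
Lemma contact s (j : 'I_J) phi x e : s * s = 1 -> smooth phi ->
  locmax (Dom P) (fun y => ulim (@gpt j) (@gval s j) y - s * phi y) x -> 0 < e ->
  exists m (i : 'I_(Nn Sc m j)) t v vo r q p M,
  [/\ (t <= Nt Sc m)%N,
      v i = usol Sc i t /\ (forall a, s * usol Sc a t <= s * v a),
      s * usol Sc i t.-1 <= s * vo,
      forall w, `|Gsch P t i (usol Sc i t) v vo w - Fop P j (xnode Sc i t) r q p M w| <= e &
      forall k, s * utilde k t.-1 i <= ulim (@gpt k) (@gval s k) x + e / 2] /\
  forall w w' : 'rV[R]_J, `|w' - w| < e ->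
    nearF P e x (s * ulim (@gpt j) (@gval s j) x) (dtau phi x) (gradS phi x) (hessS phi x) w
            (xnode Sc i t) r q p M w'.
Proof.
move=> ss sphi lm e0; have Dx : Dom P x by case: lm.
have [C HC] := gval_bound s.
have ubd y := @ulim_bound _ _ _ _ _ _ _ (@gpt_dense j) (HC j) y.
have ssphi : smooth (fun y => s * phi y) by apply: smoothM => //; exact: smooth_cst.
have [psi [spsi psix psi1 psi2 sep]] := strict_touch Dom_compact ubd ssphi lm.
(* Undoes the sign: since [s * s = 1], [chi] has the derivatives of [phi] at [x] up to order two. *)
pose chi y := s * psi y.
have schi : smooth chi by apply: smoothM => //; exact: smooth_cst.
have chi1 v : derive chi x v = derive phi x v.
  by rewrite derive_scalefun // psi1 derive_scalefun // mulrA ss mul1r.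
have chi2 u v : derive (fun y => derive chi y u) x v = derive (fun y => derive phi y u) x v.
  have -> : (fun y => derive chi y u) = fun y => s * derive psi y u.
    by apply/funext => y; rewrite derive_scalefun.
  rewrite derive_scalefun; last exact: smooth_derive.
  rewrite psi2; have -> : (fun y => derive (fun y => s * phi y) y u) = fun y => s * derive phi y u.
    by apply/funext => y; rewrite derive_scalefun.
  rewrite derive_scalefun; last exact: smooth_derive.
  by rewrite mulrA ss mul1r.
have [om1 [om2 [om1lim om2lim Hcons]]] := consistent j schi.
have [hgrid _ _ hlim _] := grids.
have e2 : 0 < e / 2 by rewrite divr_gt0.
have om1m : \forall m \near \oo, om1 (hm Sc m) < e / 2.
  have : \forall h \near 0^'+, om1 h < e / 2 by exact: (cvgr_lt (0 : R) om1lim).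
  (* Consistency controls [om1] to the right of 0, and mesh sizes are positive. *)
  move=> [r /= r0 hr]; have : \forall m \near \oo, hm Sc m < r by exact: (cvgr_lt (0 : R) hlim).
  apply: filterS => m hmr; have [h0 _] := hgrid m; apply: hr => //=.
  by rewrite sub0r normrN gtr0_norm.
have [d1 d10 Hd1] : exists2 d1, 0 < d1 & forall xi, `|xi| < d1 -> om2 xi < e / 2.
  have : \forall xi \near (0 : R), om2 xi < e / 2 by exact: (cvgr_lt (0 : R) om2lim).
  move=> /nbhs_ballP[r r0 hr]; exists r => // xi hxi; apply: hr.
  by rewrite -ball_normE /= sub0r normrN.
have jets : \forall y \near x, [/\ `|chi y - chi x| < e,
    `|dtau chi y - dtau chi x| < e, `|gradS chi y - gradS chi x| < e
    & `|hessS chi y - hessS chi x| < e].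
  near=> y; split; near: y.
  - by apply: cvg_near_dist => //; exact: smooth_cont.
  - by apply: cvg_near_dist => //; exact/smooth_cont/smooth_derive.
  - exact: gradS_near.
  - exact: hessS_near.
move: jets => /nbhs_ballP[d2 /= d20 Hd2].
have [n [nint [nom1 [nd1 [nd2 ne]]]]] : exists n,
  (forall k, forall m, (n <= m)%N ->
    forall j (i : 'I_(Nn Sc m j)) t, (t <= Nt Sc m)%N ->
    `|xnode Sc i t - x| < n.+1%:R^-1 ->
    s * utilde k t.-1 i <= ulim (@gpt k) (@gval s k) x + e / 2) /\
  (forall m, (n <= m)%N -> om1 (hm Sc m) < e / 2) /\
  n.+1%:R^-1 < d1 /\ n.+1%:R^-1 < d2 /\ n.+1%:R^-1 < e.
  have [N _ HN] := om1m.
  have [n Hn] : exists n, (N <= n)%N /\ (n.+1%:R^-1 < d1 /\ n.+1%:R^-1 < d2 /\ n.+1%:R^-1 < e) /\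
    (forall k, forall m, (n <= m)%N ->
    forall j (i : 'I_(Nn Sc m j)) t, (t <= Nt Sc m)%N ->
    `|xnode Sc i t - x| < n.+1%:R^-1 ->
    s * utilde k t.-1 i <= ulim (@gpt k) (@gval s k) x + e / 2).
    apply: (@filter_ex _ \oo); near=> n; split; first by near: n; exact: nbhs_infty_ge.
    split.
      by repeat split; near: n; [exact: (near_infty_natSinv_lt (PosNum d10))|
        exact: (near_infty_natSinv_lt (PosNum d20))|
        exact: (near_infty_natSinv_lt (PosNum e0))].
    near: n; apply: filter_forall => k; apply: interp_near => //.
    by rewrite ltrDl.
  have [Nn [[? [? ?]] ?]] := Hn.
  exists n; split=> //; split=> // m nm; apply: HN => /=; exact: leq_trans nm.
have n0 : 0 < n.+1%:R^-1 :> R by rewrite invr_gt0.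
have [m [[i t] [nm Xi vi mx]]] := grid_touch (@gpt_dense j) (HC j)
  (fun m (a : gidx j m) => Dom_xnode a.1 (ltn_ord a.2 : (a.2 <= Nt Sc m)%N)) Dom_compact n Dx
  (smooth_cont spsi) psix sep n0.
rewrite /gpt /gval /= in Xi vi mx.
(* The gap at the contact node is the constant shift in the consistency condition; [grid_touch]
   makes it small. *)
pose y := xnode Sc i t; pose xi := usol Sc i t - chi y.
have sxi : s * xi = s * usol Sc i t - psi y by rewrite /xi /chi mulrBr mulrA ss mul1r.
have s1 : `|s| = 1.
  by apply/eqP; rewrite -(@eqrXn2 _ 2) // expr1n -normrX expr2 ss normr1.
have xismall : `|xi| < d1.
  by rewrite -[`|xi|]mul1r -s1 -normrM sxi (lt_trans vi).
have tN : (t <= Nt Sc m)%N by rewrite -ltnS.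
have tN' : (t.-1 < (Nt Sc m).+1)%N by rewrite ltnS (leq_trans (leq_pred t)).
have schiE z : s * chi z = psi z by rewrite /chi mulrA ss mul1r.
exists m, i, t, (fun a => chi (xnode Sc a t) + xi), (chi (xnode Sc i t.-1) + xi),
  (chi y), (dtau chi y), (gradS chi y), (hessS chi y).
split; [split=> //|].
- split; first by rewrite /xi addrC subrK.
  (* Maximality of the gap over the whole space-time grid orders neighbours at the same level here,
     and the value at the previous level below. *)
  move=> a; rewrite mulrDr schiE sxi; have := mx (a, t) => /=; rewrite -/y; lra.
- by rewrite mulrDr schiE sxi; have := mx (i, Ordinal tN') => /=; rewrite -/y; lra.
- move=> w; have := Hcons m i t xi w tN; rewrite /= -/y.
  have -> : chi y + xi = usol Sc i t by rewrite /xi addrC subrK.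
  move=> /le_trans; apply; have := nom1 _ nm; have := Hd1 _ xismall; lra.
- by move=> k; apply: nint => //.
move=> w w' ww.
have [h1 h2 h3 h4] : [/\ `|chi y - chi x| < e,
    `|dtau chi y - dtau chi x| < e, `|gradS chi y - gradS chi x| < e
    & `|hessS chi y - hessS chi x| < e].
  by apply: Hd2; rewrite -ball_normE /= distrC (lt_trans Xi).
have dE : dtau chi x = dtau phi x by exact: chi1.
have gE : gradS chi x = gradS phi x by apply/rowP => k; rewrite [LHS]mxE [RHS]mxE; exact: chi1.
have hE : hessS chi x = hessS phi x by apply/matrixP => k l; rewrite [LHS]mxE [RHS]mxE; exact: chi2.
rewrite dE in h2; rewrite gE in h3; rewrite hE in h4.
rewrite /chi psix in h1.
split; split; [exact: Dom_xnode | exact: lt_trans Xi ne | exact: h1 | exact: h2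
  | exact: h3 | exact: h4 | exact: ww].
Unshelve. all: by end_near. Qed.

(** [W 1] is the upper half-relaxed limit and [- W (-1)] the lower one. *)
Let W s j := ulim (@gpt j) (@gval s j).

Lemma ulim_loc_bounded s j : loc_bounded (Dom P) (W s j).
Proof.
have [C HC] := gval_bound s => x _; exists 1, C; split=> // y Dy _.
exact: (ulim_bound (@gpt_dense j) (HC j)).
Qed.

(** Half-relaxed limits are already semicontinuous, so envelopes leave them unchanged on the
    domain. *)
Lemma usc_env_ulim s j x : Dom P x -> usc_env (Dom P) (W s j) x = W s j x.
Proof.
move=> Dx; apply: usc_env_id => // [|c]; first exact: ulim_loc_bounded.
have [C HC] := gval_bound s; exact: (ulim_usc (@gpt_dense j) (HC j)).
Qed.

Lemma lsc_env_ulim s j x : Dom P x -> lsc_env (Dom P) (fun y => - W s j y) x = - W s j x.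
Proof.
move=> Dx; rewrite lsc_envN -(usc_env_ulim s j Dx); congr (- _).
by apply: eq_usc_env => y _; rewrite opprK.
Qed.

(** * The half-relaxed limits as viscosity sub- and supersolution *)

Hypotheses (solved : solves P Sc) (mono : C2 P Sc).

Lemma subsol_ulim : subsol P (W 1).
Proof.
split=> [j|j phi x sphi lm]; first exact: ulim_loc_bounded.
have Dx : Dom P x by case: lm.
have lm' : locmax (Dom P) (fun y => W 1 j y - 1 * phi y) x.
  case: lm => _ [e [e0 He]]; split=> //; exists e; split=> // y Dy xy.
  by have := He y Dy xy; rewrite !usc_env_ulim // !mul1r.
rewrite usc_env_ulim //.
have -> : \row_k usc_env (Dom P) (W 1 k) x = \row_k W 1 k x.
  by apply/rowP => k; rewrite !mxE usc_env_ulim.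
apply: Flo_le0 => e e0.
have [m [i [t [v [vo [r [q [p [M [[tN [vi uv] uvo HGF Hw] near]]]]]]]]]] :=
  contact (mulr1 1) sphi lm' e0.
have e2 : 0 < e / 2 by rewrite divr_gt0.
(* Interpolated values are bounded by the limits on one side only and need not be close to them. The
   limits raised by [e / 2] are close to the limits and dominate the interpolated values, which
   suffices for [Fop_le]. *)
exists (xnode Sc i t), r, q, p, M, (\row_k (W 1 k x + e / 2)); split.
  rewrite -[W 1 j x]mul1r; apply: near; apply: mx_norm_lt => // l k.
  by rewrite !mxE addrAC subrr add0r gtr0_norm // ltr_pdivrMr // mulr_natr mulr2n ltrDl.
pose wt := \row_k @utilde _ _ _ Sc m k j t.-1 i.
apply: (@le_trans _ _ (Fop P j (xnode Sc i t) r q p M wt)).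
  by apply: Fop_le => k; rewrite !mxE; have := Hw k; rewrite mul1r.
have G0 : Gsch P t i (usol Sc i t) (fun a => usol Sc a t) (usol Sc i t.-1) wt = 0.
  exact: solved.
(* The test data dominate the discrete solution and agree with it at the contact node, so weak
   monotonicity can only lower the zero value of the scheme. *)
have : Gsch P t i (usol Sc i t) v vo wt <= 0.
  rewrite -G0; apply: mono => //; last by move: uvo; rewrite !mul1r.
  by move=> a _; have := uv a; rewrite !mul1r.
have := HGF wt; rewrite ler_norml => /andP[? ?] ?; lra.
Qed.

(** With sign -1 the contact inequalities reverse: the test data lie below the discrete solution, so
    the scheme takes a nonnegative value. *)
Lemma supersol_llim : supersol P (fun j y => - W (-1) j y).
Proof.
split=> [j|j phi x sphi lm]; first exact/loc_boundedN/ulim_loc_bounded.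
have Dx : Dom P x by case: lm.
have lm' : locmax (Dom P) (fun y => W (-1) j y - (-1) * phi y) x.
  case: lm => _ [e [e0 He]]; split=> //; exists e; split=> // y Dy xy.
  by have := He y Dy xy; rewrite !lsc_env_ulim // !mulN1r; lra.
rewrite lsc_env_ulim //.
have -> : \row_k lsc_env (Dom P) (fun y => - W (-1) k y) x = \row_k - W (-1) k x.
  by apply/rowP => k; rewrite !mxE lsc_env_ulim.
apply: Fup_ge0 => e e0.
have ss : -1 * -1 = 1 :> R by rewrite mulN1r opprK.
have [m [i [t [v [vo [r [q [p [M [[tN [vi uv] uvo HGF Hw] near]]]]]]]]]] :=
  contact ss sphi lm' e0.
have e2 : 0 < e / 2 by rewrite divr_gt0.
exists (xnode Sc i t), r, q, p, M, (\row_k (- W (-1) k x - e / 2)); split.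
  rewrite -[- W (-1) j x]mulN1r; apply: near; apply: mx_norm_lt => // l k.
  rewrite !mxE addrAC subrr add0r normrN gtr0_norm //.
  by rewrite ltr_pdivrMr // mulr_natr mulr2n ltrDl.
pose wt := \row_k @utilde _ _ _ Sc m k j t.-1 i.
apply: (@le_trans _ _ (Fop P j (xnode Sc i t) r q p M wt)); last first.
  by apply: Fop_le => k; rewrite !mxE; have := Hw k; rewrite mulN1r -/(W _ _); lra.
have G0 : Gsch P t i (usol Sc i t) (fun a => usol Sc a t) (usol Sc i t.-1) wt = 0.
  exact: solved.
have : 0 <= Gsch P t i (usol Sc i t) v vo wt.
  rewrite -G0; apply: mono => //; last by move: uvo; rewrite !mulN1r lerN2.
  by move=> a _; have := uv a; rewrite !mulN1r lerN2.
have := HGF wt; rewrite ler_norml => /andP[? ?] ?; lra.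
Qed.

(** * Consequences of strong comparison *)

Hypothesis comparison : strong_comparison P.

Lemma ulim_eq_llim j x : Dom P x -> - W (-1) j x = W 1 j x.
Proof.
move=> Dx; apply/eqP; rewrite eq_le; apply/andP; split.
  have [C HC] := gval_bound 1.
  have := llim_le_ulim (@gpt_dense j) (HC j) Dx; apply: le_trans.
  rewrite /llim lerN2 (_ : (fun m i => - gval 1 i) = @gval (-1) j) //.
  by apply: functional_extensionality_dep => m; apply/funext => a; rewrite /gval mul1r mulN1r.
have := comparison subsol_ulim supersol_llim j Dx.
by rewrite usc_env_ulim // lsc_env_ulim.
Qed.

(** Both [W 1] and [W (-1)] are upper semicontinuous, and on the domain they are opposite. *)
Lemma ulim_continuous j x e : Dom P x -> 0 < e -> exists r, 0 < r /\
  forall y, Dom P y -> `|y - x| < r -> `|W 1 j y - W 1 j x| <= e.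
Proof.
move=> Dx e0.
have lt s : W s j x < W s j x + e by rewrite ltrDl.
have usc s : exists r, 0 < r /\ forall y, Dom P y -> `|y - x| < r -> W s j y <= W s j x + e.
  have [C HC] := gval_bound s; exact: (ulim_usc (@gpt_dense j) (HC j) Dx (lt s)).
have [r1 [r10 H1]] := usc 1; have [r2 [r20 H2]] := usc (-1).
exists (Num.min r1 r2); split=> [|y Dy]; first by rewrite lt_min r10.
rewrite lt_min => /andP[/(H1 y Dy) ? /(H2 y Dy)].
rewrite -[W (-1) j y]opprK -[W (-1) j x]opprK !ulim_eq_llim // ler_norml => ?.
by apply/andP; split; lra.
Qed.

(** The supersolution property passes from the lower to the upper limit, as envelopes see only
    values on the domain, where the two agree. *)
Lemma visc_sol_ulim : visc_sol P (W 1).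
Proof.
split; first exact: subsol_ulim.
have [_ H] := supersol_llim; split=> [j|j phi x sphi]; first exact: ulim_loc_bounded.
have E k : lsc_env (Dom P) (W 1 k) = lsc_env (Dom P) (fun y => - W (-1) k y).
  by apply/funext => y; apply: eq_lsc_env => z Dz; rewrite ulim_eq_llim.
have -> : \row_k lsc_env (Dom P) (W 1 k) x = \row_k lsc_env (Dom P) (fun y => - W (-1) k y) x.
  by apply/rowP => k; rewrite !mxE E.
by rewrite E; exact: H.
Qed.

(** Near each point the two signs bound the nodal values within [e / 2] of the limit at that point,
    continuity costs another [e / 2], and [near_nodes] makes the threshold uniform. *)
Lemma ulim_uniform_limit e : 0 < e -> \forall m \near \oo,
  forall j (i : 'I_(Nn Sc m j)) t, (t <= Nt Sc m)%N ->
  `|usol Sc i t - W 1 j (xnode Sc i t)| <= e.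
Proof.
move=> e0; apply: filter_forall => j.
have e2 : 0 < e / 2 by rewrite divr_gt0.
have [N HN] : exists N, forall m, (N <= m)%N -> forall a : gidx j m,
    `|usol Sc a.1 a.2 - W 1 j (gpt a)| <= e.
  apply: (near_nodes (D := Dom P)) => [m a||x Dx].
  - exact: (Dom_xnode a.1 (ltn_ord a.2 : (a.2 <= Nt Sc m)%N)).
  - exact: Dom_compact.
  have ev s : evub (@gpt j) (@gval s j) x (W s j x + e / 2).
    have [C HC] := gval_bound s; apply: (ulim_ltP (@gpt_dense j) (HC j) Dx).
    by rewrite ltrDl.
  have [r1 [N1 [r10 H1]]] := ev 1; have [r2 [N2 [r20 H2]]] := ev (-1).
  have [r3 [r30 H3]] := ulim_continuous j Dx e2.
  exists (Num.min r1 (Num.min r2 r3)), (maxn N1 N2); split.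
    by rewrite !lt_min r10 r20.
  move=> m; rewrite geq_max => /andP[N1m N2m] a; rewrite !lt_min => /and3P[a1 a2 a3].
  have := H1 m N1m a a1; have := H2 m N2m a a2.
  have := H3 _ (Dom_xnode a.1 (ltn_ord a.2 : (a.2 <= Nt Sc m)%N)) a3.
  rewrite /gval mulN1r mul1r -[W (-1) j x]opprK ulim_eq_llim // /gpt.
  by rewrite !ler_norml => /andP[? ?] ? ?; apply/andP; split; lra.
exists N => // m Nm i t tN.
by have := HN m Nm (i, Ordinal (tN : (t < (Nt Sc m).+1)%N)).
Qed.

End Scheme.

(** Comparison between envelopes orders any subsolution below any supersolution; apply it both
    ways. *)
Lemma visc_sol_unique (R : realType) (d J : nat) (P : @pde_data R d J)
    (U V : 'I_J -> @pt R d -> R) : strong_comparison P ->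
  visc_sol P U -> visc_sol P V -> forall j x, Dom P x -> V j x = U j x.
Proof.
move=> cmp solU solV.
have le U1 U2 : subsol P U1 -> supersol P U2 -> forall j x, Dom P x -> U1 j x <= U2 j x.
  move=> s1 s2 j x Dx; apply: le_trans (usc_env_ge (s1.1 j) Dx) _.
  by apply: le_trans (cmp _ _ s1 s2 j x Dx) _; exact: lsc_env_le (s2.1 j) Dx.
move=> j x Dx; apply/eqP; rewrite eq_le.
by rewrite (le _ _ solU.1 solV.2) // (le _ _ solV.1 solU.2).
Qed.

Theorem mainTheorem3 (R : realType) (d J : nat)
  (P : @pde_data R d J) (Sc : @scheme_data R d J) :
  data_hyp P -> strong_comparison P ->
  grid_hyp P Sc -> solves P Sc ->
  C1 Sc -> C2 P Sc -> C3 Sc -> C4 P Sc ->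
  exists U : 'I_J -> pt -> R,
    [/\ visc_sol P U,
        (forall j, {within Dom P, continuous (U j)}),
        (forall V : 'I_J -> pt -> R, visc_sol P V ->
           (forall j, {within Dom P, continuous (V j)}) ->
           forall j x, Dom P x -> V j x = U j x) &
        (forall e : R, 0 < e -> \forall m \near \oo,
           forall j (i : 'I_(Nn Sc m j)) t, (t <= Nt Sc m)%N ->
             `|usol Sc i t - U j (xnode Sc i t)| <= e)].
Proof.
move=> Pdata cmp grids solved c1 c2 c3 c4.
have vs := visc_sol_ulim Pdata grids c1 c3 c4 solved c2 cmp.
exists (fun j => ulim (@gpt _ _ _ Sc j) (@gval _ _ _ Sc 1 j)); split=> //.
- move=> j; apply/subspace_continuousP => x Dx; apply/cvgrPdist_le => e e0.
  have [r [r0 Hr]] := ulim_continuous Pdata grids c1 c3 c4 solved c2 cmp j Dx e0.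
  rewrite near_withinE; apply/nbhs_ballP; exists r => // y xy Dy.
  by rewrite distrC; apply: Hr => //; move: xy; rewrite -ball_normE /= distrC.
- by move=> V sV _; exact: visc_sol_unique cmp vs sV.
- by move=> e e0; exact: (ulim_uniform_limit Pdata grids c1 c3 c4 solved c2 cmp e0).
Qed.
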